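(* Let $n=2p^t$ with $p$ an odd prime and $t\ge 1$ an integer, and suppose $d=n^2+1$ is square-free (so $d\equiv 5\pmod 8$). Suppose $h(d)=q^r$ for some prime $q$ and integer $r\ge 2$. If $t>q^{r-1}$, then $\mathfrak{C}(k_n)\cong \mathbb{Z}_{q^r}$.
   Context: $k_n=\mathbb{Q}(\sqrt d)$, $h(d)$ is its class number and $\mathfrak{C}(k_n)$ its ideal class group. $\mathbb{Z}_{N}$ denotes the cyclic group of order $N$. *)

(* Defs.v *)
From HB Require Import structures.
From mathcomp Require Import all_boot all_order all_algebra all_field.
From mathcomp Require Import finmap.
From mathcomp Require Import boolp classical_sets cardinality.

Set Implicit Arguments.
Unset Strict Implicit.
Unset Printing Implicit Defensive.

Import Order.TTheory GRing.Theory Num.Theory.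
Local Open Scope ring_scope.
Local Open Scope classical_set_scope.
Local Open Scope quotient_scope.

Definition squarefree (m : nat) : Prop :=
  forall l : nat, prime l -> ~~ (l ^ 2 %| m)%N.

Definition is_rat_sqrt_field (d : nat) (K : fieldExtType rat) : Prop :=
  exists2 s : K, s ^+ 2 = d%:R & <<1; s>>%VS = fullv.

Lemma rat_sqrt_field_exists (d : nat) :
  exists K : fieldExtType rat, is_rat_sqrt_field d K.
Proof.
have [K [KC [[|s []] // [Ds] genK]]] := num_field_exists [:: sqrtC (d%:R : algC)].
exists K; exists s; last by rewrite -genK /= adjoin_seq1.
by apply: (fmorph_inj KC); rewrite rmorphXn /= Ds sqrtCK rmorph_nat.
Qed.

Section ClassGroup.

Variable K : fieldExtType rat.

Definition ring_of_integers : set K :=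
  [set x : K | integralOver (intr : int -> K) x].

Local Notation OK := ring_of_integers.

Lemma OK1 : OK 1. Proof. exact: (@integral1 _ _ (intr : {rmorphism int -> K})). Qed.

Lemma OKM (x y : K) : OK x -> OK y -> OK (x * y).
Proof. exact: (@integral_mul _ _ (intr : {rmorphism int -> K})). Qed.

Lemma OK0 : OK 0. Proof. exact: (@integral0 _ _ (intr : {rmorphism int -> K})). Qed.

Lemma OKD (x y : K) : OK x -> OK y -> OK (x + y).
Proof. exact: (@integral_add _ _ (intr : {rmorphism int -> K})). Qed.

(* Only nonzero fractional ideals are considered; closure under opposites is  *)
(* the third clause with a = -1.                                              *)
Definition is_frac_ideal (I : set K) : Prop :=
  [/\ I 0,
      forall x y, I x -> I y -> I (x + y),
      forall a x, OK a -> I x -> I (a * x),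
      exists2 x, I x & x != 0
    & exists2 c, OK c /\ c != 0 & forall x, I x -> OK (c * x)].

Definition ideal_mul (I J : set K) : set K :=
  [set z | exists2 s : seq (K * K),
     {in s, forall u, I u.1 /\ J u.2} & z = \sum_(u <- s) u.1 * u.2].

Definition ideal_scale (a : K) (I : set K) : set K := [set a * x | x in I].

Lemma ideal_mul_gen (I J : set K) x y : I x -> J y -> ideal_mul I J (x * y).
Proof.
move=> Ix Jy; exists [:: (x, y)]; last by rewrite big_seq1.
by move=> u; rewrite inE => /eqP->.
Qed.

Lemma ideal_mul0 (I J : set K) : ideal_mul I J 0.
Proof. by exists [::]; rewrite ?big_nil. Qed.

Lemma ideal_mulD (I J : set K) x y :
  ideal_mul I J x -> ideal_mul I J y -> ideal_mul I J (x + y).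
Proof.
move=> [s sP ->] [t tP ->]; exists (s ++ t); last by rewrite big_cat.
by move=> u; rewrite mem_cat => /orP[/sP|/tP].
Qed.

Lemma ideal_mul_min (I J S : set K) :
    S 0 -> (forall x y, S x -> S y -> S (x + y)) ->
    (forall x y, I x -> J y -> S (x * y)) ->
  ideal_mul I J `<=` S.
Proof.
move=> S0 SD SM z [s sP ->]; elim: s sP => [|u s IHs] sP; first by rewrite big_nil.
rewrite big_cons; apply: SD.
  by have [Iu Ju] := sP u (mem_head _ _); apply: SM.
by apply: IHs => v vs; apply: sP; rewrite inE vs orbT.
Qed.

Lemma ideal_mulC (I J : set K) : ideal_mul I J = ideal_mul J I.
Proof.
by apply/seteqP; split; apply: ideal_mul_min;
  do ?[exact: ideal_mul0 | exact: ideal_mulD];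
  move=> x y ? ?; rewrite mulrC; apply: ideal_mul_gen.
Qed.

Lemma ideal_mulA_sub (I1 I2 I3 : set K) :
  ideal_mul I1 (ideal_mul I2 I3) `<=` ideal_mul (ideal_mul I1 I2) I3.
Proof.
apply: ideal_mul_min; [exact: ideal_mul0 | exact: ideal_mulD |].
move=> x y Ix.
apply: (@ideal_mul_min _ _ [set y | ideal_mul (ideal_mul I1 I2) I3 (x * y)]) => /=.
- by rewrite mulr0; apply: ideal_mul0.
- by move=> u v Hu Hv; rewrite mulrDr; apply: ideal_mulD.
- by move=> u v Hu Hv; rewrite mulrA; do 2?apply: ideal_mul_gen.
Qed.

Lemma ideal_mulA (I1 I2 I3 : set K) :
  ideal_mul I1 (ideal_mul I2 I3) = ideal_mul (ideal_mul I1 I2) I3.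
Proof.
apply/seteqP; split; first exact: ideal_mulA_sub.
rewrite ideal_mulC (ideal_mulC I1 I2) (ideal_mulC I1) (ideal_mulC I2 I3).
exact: ideal_mulA_sub.
Qed.

Lemma ideal_mul1 (I : set K) : is_frac_ideal I -> ideal_mul OK I = I.
Proof.
case=> I0 ID IZ _ _; apply/seteqP; split; first exact: ideal_mul_min.
by move=> x Ix; rewrite -[x]mul1r; apply: ideal_mul_gen => //; apply: OK1.
Qed.

Lemma ideal_scaleMl a (I J : set K) :
  ideal_mul (ideal_scale a I) J = ideal_scale a (ideal_mul I J).
Proof.
apply/seteqP; split.
  apply: ideal_mul_min.
  - by exists 0; [exact: ideal_mul0 | rewrite mulr0].
  - move=> _ _ [x Hx <-] [y Hy <-]; exists (x + y); last by rewrite mulrDr.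
    exact: ideal_mulD.
  - move=> _ y [x Hx <-] Hy; exists (x * y); last by rewrite mulrA.
    exact: ideal_mul_gen.
move=> _ [z Hz <-]; move: z Hz.
apply: (@ideal_mul_min _ _ [set z | ideal_mul (ideal_scale a I) J (a * z)]) => /=.
- by rewrite mulr0; apply: ideal_mul0.
- by move=> u v Hu Hv; rewrite mulrDr; apply: ideal_mulD.
- by move=> u v Hu Hv; rewrite mulrA; apply: ideal_mul_gen => //; exists u.
Qed.

Lemma ideal_scale_comp a b (I : set K) :
  ideal_scale a (ideal_scale b I) = ideal_scale (a * b) I.
Proof.
apply/seteqP; split=> [_ [_ [x Ix <-] <-]|_ [x Ix <-]].
  by exists x; rewrite // mulrA.
by exists (b * x); rewrite ?mulrA //; exists x.
Qed.

Lemma ideal_scale1 (I : set K) : ideal_scale 1 I = I.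
Proof.
apply/seteqP; split=> [_ [x Ix <-]|x Ix]; first by rewrite mul1r.
by exists x; rewrite ?mul1r.
Qed.

Lemma is_frac_idealM (I J : set K) :
  is_frac_ideal I -> is_frac_ideal J -> is_frac_ideal (ideal_mul I J).
Proof.
move=> [I0 ID IZ [x Ix x0] [a [Oa a0] Ia]] [J0 JD JZ [y Jy y0] [b [Ob b0] Jb]].
split; [exact: ideal_mul0 | exact: ideal_mulD | | |].
- move=> c z Oc; move: z.
  apply: (@ideal_mul_min _ _ [set z | ideal_mul I J (c * z)]) => /=.
  + by rewrite mulr0; apply: ideal_mul0.
  + by move=> u v Hu Hv; rewrite mulrDr; apply: ideal_mulD.
  + by move=> u v Hu Hv; rewrite mulrA; apply: ideal_mul_gen => //; apply: IZ.
- by exists (x * y); [exact: ideal_mul_gen | rewrite mulf_neq0].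
- exists (a * b); first by split; [exact: OKM | rewrite mulf_neq0].
  apply: (@ideal_mul_min _ _ [set z | OK (a * b * z)]) => /=.
  + by rewrite mulr0; apply: OK0.
  + by move=> u v Hu Hv; rewrite mulrDr; apply: OKD.
  + by move=> u v Hu Hv; rewrite mulrACA; apply: OKM; [apply: Ia|apply: Jb].
Qed.

Lemma is_frac_ideal1 : is_frac_ideal OK.
Proof.
split; [exact: OK0 | exact: OKD | exact: OKM | |].
  by exists 1; rewrite ?oner_neq0 //; apply: OK1.
by exists 1; [split; [exact: OK1 | exact: oner_neq0] | move=> x; rewrite mul1r].
Qed.

Definition frac_ideal := {I : set K | `[< is_frac_ideal I >]}.

Lemma frac_idealP (I : frac_ideal) : is_frac_ideal (val I).
Proof. exact/asboolP/(valP I). Qed.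

Definition frac_ideal_mul (I J : frac_ideal) : frac_ideal :=
  Sub (ideal_mul (val I) (val J))
      (asboolT (is_frac_idealM (frac_idealP I) (frac_idealP J))).

Definition frac_ideal_one : frac_ideal := Sub OK (asboolT is_frac_ideal1).

(* I = a J for some nonzero a in K, that is, I and J differ by the principal  *)
(* fractional ideal generated by a.                                           *)
Definition ideal_equiv (I J : frac_ideal) : bool :=
  `[< exists2 a : K, a != 0 & val I = ideal_scale a (val J) >].

Lemma ideal_equiv_refl : reflexive ideal_equiv.
Proof. by move=> I; apply/asboolP; exists 1; rewrite ?oner_neq0 ?ideal_scale1. Qed.

Lemma ideal_equiv_sym : symmetric ideal_equiv.
Proof.
suff H I J : ideal_equiv I J -> ideal_equiv J I by move=> I J; apply/idP/idP; apply: H.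
case/asboolP=> a a0 E; apply/asboolP; exists a^-1; first by rewrite invr_neq0.
by rewrite E ideal_scale_comp mulVf // ideal_scale1.
Qed.

Lemma ideal_equiv_trans : transitive ideal_equiv.
Proof.
move=> J I L /asboolP[a a0 Ea] /asboolP[b b0 Eb]; apply/asboolP.
by exists (a * b); rewrite ?mulf_neq0 // Ea Eb ideal_scale_comp.
Qed.

Canonical ideal_equiv_rel :=
  EquivRel ideal_equiv ideal_equiv_refl ideal_equiv_sym ideal_equiv_trans.

Definition class_group := {eq_quot ideal_equiv}.

HB.instance Definition _ := Choice.on class_group.
HB.instance Definition _ := EqQuotient.on class_group.

Definition ideal_class (I : frac_ideal) : class_group := \pi I.

Definition class_mul (x y : class_group) : class_group :=
  ideal_class (frac_ideal_mul (repr x) (repr y)).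

Definition class_one : class_group := ideal_class frac_ideal_one.

Lemma ideal_classP (I J : frac_ideal) :
  ideal_class I = ideal_class J <->
  exists2 a : K, a != 0 & val I = ideal_scale a (val J).
Proof.
split=> [/eqmodP/asboolP // | E].
by apply/eqmodP/asboolP.
Qed.

Lemma class_mulE (I J : frac_ideal) :
  class_mul (ideal_class I) (ideal_class J) = ideal_class (frac_ideal_mul I J).
Proof.
have [a a0 Ea] : exists2 a : K, a != 0 & val (repr (ideal_class I)) = ideal_scale a (val I).
  by apply/ideal_classP; apply: reprK.
have [b b0 Eb] : exists2 b : K, b != 0 & val (repr (ideal_class J)) = ideal_scale b (val J).
  by apply/ideal_classP; apply: reprK.
apply/ideal_classP; exists (a * b); first by rewrite mulf_neq0.
rewrite /= Ea Eb ideal_scaleMl ideal_mulC ideal_scaleMl ideal_scale_comp.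
by rewrite ideal_mulC.
Qed.

Lemma class_mulA : associative class_mul.
Proof.
move=> x y z; rewrite -(reprK x) -(reprK y) -(reprK z).
rewrite -!/(ideal_class _) !class_mulE; congr ideal_class; apply: val_inj.
exact: ideal_mulA.
Qed.

Lemma class_mulC : commutative class_mul.
Proof.
by move=> x y; congr ideal_class; apply: val_inj; apply: ideal_mulC.
Qed.

Lemma class_mul1 : left_id class_one class_mul.
Proof.
move=> x; rewrite -(reprK x) -!/(ideal_class _) class_mulE; congr ideal_class.
by apply: val_inj; apply: ideal_mul1; apply: frac_idealP.
Qed.

Lemma class_mulr1 : right_id class_one class_mul.
Proof. by move=> x; rewrite class_mulC class_mul1. Qed.

(* Since the ring of integers is a Dedekind domain this monoid is a group.    *)
(* Inverses are determined by the multiplication, so an isomorphism with a    *)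
(* group is the same as a bijection compatible with the multiplications.      *)
HB.instance Definition _ :=
  isMonoid.Build class_group class_mulA class_mul1 class_mulr1.

(* fset_set of an infinite set is empty, but class groups are finite.          *)
Definition class_number : nat := #|` fset_set [set: class_group] |%fset.

End ClassGroup.

(* Main.v *)
(* In Q(sqrt d) with d = n^2 + 1 and n = 2 p^t, put w = (1 + sqrt d) / 2 and   *)
(* let P be the ideal (p, w), of norm p. If P^k (k > 0) is principal, its      *)
(* generator has norm of absolute value at most p^k. When k < t this is less   *)
(* than n / 2, and multiplication by powers of the unit n + sqrt d brings such *)
(* an element to a rational integer m. Then p divides m^2, while m divides the *)
(* trace of w^k, which is 1 modulo p: a contradiction. Hence the class of P    *)
(* has order at least t > q^(r-1), and this order divides q^r.                 *)

Require Import Defs.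
From HB Require Import structures.
From mathcomp Require Import all_boot all_order all_algebra all_field.
From mathcomp Require Import finmap boolp classical_sets cardinality.
From mathcomp Require Import zify ring lra.

Set Implicit Arguments.
Unset Strict Implicit.
Unset Printing Implicit Defensive.

Import Order.TTheory GRing.Theory Num.Theory.
Local Open Scope ring_scope.

(** An abelian group of order q^r is cyclic once some element has order larger than q^(r-1), because
    all orders divide q^r. The class of P = (p, w) is such an element: [prime_class_order] shows
    that its order is at least t. If P^k = (g) with 0 < k < t, then N(g) divides p^k, since p^k lies
    in P^k times its conjugate ([Pk_norm]), so |N(g)| < p^t = n / 2. By [small_norm_associate], g is
    then a unit times a rational integer m. As m lies in P, p divides m ([P_norm]); as w^k lies in
    P^k = (m), m divides the trace of w^k, which is 1 modulo p ([trace_wX]).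

    Classes are invertible because an integral ideal times its conjugate is principal
    ([ideal_mul_conj], [class_mul_inv]). This gives c^h = 1 for every class c ([class_expg_number])
    and lets [cyclic_class_group] turn an element of full order into the isomorphism. *)

(** * Integer inequalities behind the descent *)

(** Both (n + 1)^2 and (n - 1)^2 differ from n^2 + 1 by 2n, so A outside the window would give |4v|
    >= 2n B^2 >= 2n. The lower bound (n - 1) B < A is written without subtraction. *)
Lemma small_norm_window (n A B : nat) (v : int) :
    (0 < B)%N -> 4 * v = A%:Z ^+ 2 - (n%:Z ^+ 2 + 1) * B%:Z ^+ 2 ->
    (2 * `|v| < n)%N ->
  (A < n.+1 * B)%N /\ (n * B < A + B)%N.
Proof.
move=> B0 HA v_lt; have nB : n%:Z <= n%:Z * B%:Z ^+ 2.
  by rewrite ler_peMr // expr_ge1 //; lia.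
have [v_lo v_hi] : - (2 * n%:Z) < 4 * v /\ 4 * v < 2 * n%:Z by lia.
split; rewrite ltnNge; apply/negP=> HH.
  have : (n%:Z * B%:Z + B%:Z) ^+ 2 <= A%:Z ^+ 2 by rewrite ler_pXn2r ?nnegrE; lia.
  by clear -v_hi HA nB; lra.
have : A%:Z ^+ 2 <= (n%:Z * B%:Z - B%:Z) ^+ 2 by rewrite ler_pXn2r ?nnegrE; lia.
by clear -v_lo HA nB; lra.
Qed.

(** Choosing e so that e b and a have opposite signs, the new value is | |a| - n |b| |, which the
    window makes smaller than |b|. *)
Lemma small_norm_shift (n : nat) (a b : int) :
    (`|a| < n.+1 * `|b|)%N -> (n * `|b| < `|a| + `|b|)%N ->
  exists e : int, e ^+ 2 = 1 /\ (`|(a + e * n%:Z * b)%R| < `|b|)%N.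
Proof.
case: a => a; case: b => b H1 H2;
  by [exists (-1); split=> //; lia | exists 1; split=> //; lia].
Qed.

(** * Rationality consequences of a square-free d *)

(** A prime l dividing the denominator of b is coprime to its numerator, so clearing denominators
    would give l^2 | d. *)
Lemma squarefree_ratr_sq (d : nat) (b : rat) (m : int) :
  squarefree d -> d%:R * b ^+ 2 = m%:~R -> exists z : int, b = z%:~R.
Proof.
move=> sqf Hm.
have Dn : d%:Z * numq b ^+ 2 = m * denq b ^+ 2.
  apply: (@intr_inj rat); rewrite [LHS]rmorphM [RHS]rmorphM /= !rmorphXn /= -Hm.
  have den0 : (denq b)%:~R != 0 :> rat by rewrite intr_eq0 denq_neq0.
  by rewrite -{2}[b]divq_num_den expr_div_n; field.
have Dabs : (d * `|numq b| ^ 2 = `|m| * `|denq b| ^ 2)%N.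
  by move/(congr1 absz): Dn; rewrite [LHS]abszM [RHS]abszM !abszX.
have [den1|] := leqP `|denq b|%N 1.
  exists (numq b); have -> : b = (numq b)%:~R / (denq b)%:~R by rewrite divq_num_den.
  have -> : denq b = 1 by have := denq_gt0 b; lia.
  by rewrite mulr1 numq_int.
move=> /[dup] den_gt1 /pdiv_prime pr_l; have l_dvd := pdiv_dvd `|denq b|%N.
set l := pdiv _ in pr_l l_dvd; case/negP: (sqf l pr_l).
have cop : coprime (l ^ 2) (`|numq b| ^ 2).
  rewrite coprimeXl ?coprimeXr //.
  by apply: (coprime_dvdl l_dvd); rewrite coprime_sym; apply: coprime_num_den.
by rewrite -(Gauss_dvdl _ cop) Dabs dvdn_mull // dvdn_exp2r.
Qed.

Lemma squarefree_not_rat_sq (d : nat) (a : rat) :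
  squarefree d -> (1 < d)%N -> a ^+ 2 <> d%:R.
Proof.
move=> sqf d1 Ha; have d0 : d%:R != 0 :> rat by rewrite pnatr_eq0; lia.
have E : d%:R * (a / d%:R) ^+ 2 = 1%:~R :> rat.
  by rewrite expr_div_n Ha; field.
have [z Hz] := squarefree_ratr_sq sqf E.
have : (d%:Z * z ^+ 2)%:~R = 1%:~R :> rat by rewrite rmorphM rmorphXn /= -Hz.
move/(@intr_inj rat)/(congr1 absz); rewrite abszM abszX /= => /eqP.
by rewrite muln_eq1 => /andP[/eqP dE _]; rewrite dE in d1.
Qed.

(** * Rational scalars inside K *)

Section RationalScalars.

Variable K : fieldExtType rat.

Lemma rat_algD (a b : rat) : (a + b)%:A = a%:A + b%:A :> K.
Proof. exact: (rmorphD (in_alg K)). Qed.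

Lemma rat_algB (a b : rat) : (a - b)%:A = a%:A - b%:A :> K.
Proof. exact: (rmorphB (in_alg K)). Qed.

Lemma rat_algM (a b : rat) : (a * b)%:A = a%:A * b%:A :> K.
Proof. exact: (rmorphM (in_alg K)). Qed.

Lemma rat_algX (a : rat) m : (a ^+ m)%:A = a%:A ^+ m :> K.
Proof. exact: (rmorphXn (in_alg K)). Qed.

Lemma rat_alg_nat m : (m%:R : rat)%:A = m%:R :> K.
Proof. exact: (rmorph_nat (in_alg K)). Qed.

Lemma rat_alg_int m : (m%:~R : rat)%:A = m%:~R :> K.
Proof. exact: (rmorph_int (in_alg K)). Qed.

Lemma rat_alg_inj (a b : rat) : a%:A = b%:A :> K -> a = b.
Proof. exact: (fmorph_inj (in_alg K)). Qed.

Lemma natr_ext_neq0 m : (0 < m)%N -> m%:R != 0 :> K.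
Proof. by rewrite -rat_alg_nat scaler_eq0 oner_eq0 orbF pnatr_eq0 -lt0n. Qed.

Definition rat_algE :=
  (rat_alg_nat, rat_alg_int, rat_algX, rat_algM, rat_algB, rat_algD).

End RationalScalars.

(** * Coordinates, conjugation and integers of Q(sqrt d) *)

Section QuadraticField.

Variables (K : fieldExtType rat) (d : nat) (s : K).
Hypotheses (s2 : s ^+ 2 = d%:R) (gen : <<1; s>>%VS = fullv).
Hypotheses (d_sqf : squarefree d) (d_gt1 : (1 < d)%N).

Local Notation OK := (@ring_of_integers K).

Lemma quad_coord (x : K) : exists ab : rat * rat, x = ab.1%:A + ab.2%:A * s.
Proof.
have /Fadjoin_polyP [q /polyOver1P [{}q ->] ->] : x \in <<1; s>>%VS.
  by rewrite gen memvf.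
elim/poly_ind: q => [|q c [[a b] /= IH]].
  by exists (0, 0); rewrite rmorph0 horner0 !scale0r mul0r addr0.
exists (d%:R * b + c, a); rewrite /= rmorphD rmorphM /= map_polyX map_polyC /=.
by rewrite hornerMXaddC IH /= !rat_algE -s2; ring.
Qed.

(** Otherwise s would be a quotient of rationals, against [squarefree_not_rat_sq]. *)
Lemma quad_coord_inj (a b a' b' : rat) :
  a%:A + b%:A * s = a'%:A + b'%:A * s -> a = a' /\ b = b'.
Proof.
move=> E; have {}E : (a - a')%:A = (b' - b)%:A * s.
  have {}E : a%:A + b%:A * s - (a'%:A + b'%:A * s) = 0 by rewrite E subrr.
  by rewrite !rat_algE; apply/eqP; rewrite -subr_eq0 -[X in _ == X]E; apply/eqP; ring.
have [b0|b0] := eqVneq (b' - b) 0.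
  move: E; rewrite b0 scale0r mul0r => /eqP; rewrite scaler_eq0 oner_eq0 orbF.
  by move/eqP=> a0; lra.
case: (@squarefree_not_rat_sq d ((a - a') / (b' - b)) d_sqf d_gt1).
apply: (@rat_alg_inj K); rewrite rat_algX rat_alg_nat -s2 rat_algM E; congr (_ ^+ 2).
by rewrite mulrAC -rat_algM mulfV // scale1r mul1r.
Qed.

(** The nontrivial automorphism is built on chosen coordinates; their uniqueness makes it a ring
    morphism. *)
Lemma quad_conj : exists sg : {rmorphism K -> K},
  sg s = - s /\ forall a : rat, sg a%:A = a%:A.
Proof.
have [co coP] := choice quad_coord.
pose f x : K := (co x).1%:A - (co x).2%:A * s.
have fE a b x : x = a%:A + b%:A * s -> f x = a%:A - b%:A * s.
  by rewrite {1}(coP x) => /quad_coord_inj[] <- <-.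
have fB : zmod_morphism f.
  move=> x y; rewrite (@fE ((co x).1 - (co y).1) ((co x).2 - (co y).2)).
    by rewrite /f !rat_algE; ring.
  by rewrite {1}(coP x) {1}(coP y) !rat_algE; ring.
have fM : monoid_morphism f.
  split.
    by rewrite (@fE 1 0) ?scale0r ?mul0r ?subr0 ?addr0 scale1r.
  move=> x y; set a := (co x).1; set b := (co x).2.
  set a' := (co y).1; set b' := (co y).2.
  have Ea := coP x; have Eb := coP y; rewrite -/a -/b -/a' -/b' in Ea Eb.
  rewrite (@fE (a * a' + d%:R * (b * b')) (a * b' + a' * b)).
    by rewrite /f -/a -/b -/a' -/b' !rat_algE -s2; ring.
  by rewrite {1}Ea {1}Eb !rat_algE -s2; ring.
pose sg : {rmorphism K -> K} := HB.pack f
  (GRing.isZmodMorphism.Build _ _ f fB) (GRing.isMonoidMorphism.Build _ _ f fM).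
exists sg; split.
  by rewrite /sg /= (@fE 0 1) ?scale0r ?scale1r ?mul1r ?sub0r ?add0r.
by move=> a; rewrite /sg /= (@fE a 0) ?scale0r ?mul0r ?subr0 ?addr0.
Qed.

(** The monic integer polynomial is moved to [algC], where rational algebraic integers are known to
    be integers. *)
Lemma ratr_integral (a : rat) : OK a%:A -> exists z : int, a = z%:~R.
Proof.
case=> q mq.
have -> : map_poly (intr : int -> K) q = map_poly (in_alg K) (map_poly intr q).
  rewrite -map_poly_comp; apply: eq_map_poly => z /=.
  by rewrite -[LHS](rmorph_int (in_alg K)).
rewrite fmorph_root => rq.
have : ratr a \in Aint.
  apply: (@root_monic_Aint (map_poly ratr (map_poly intr q))).
  - by rewrite fmorph_root.
  - by rewrite !monic_map.
  - rewrite -map_poly_comp; apply/polyOverP=> i; rewrite coef_map /= ratr_int.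
    exact: intr_int.
move/(Cint_rat_Aint (Crat_rat _)) => /intrP[z Hz]; exists z.
by apply: (fmorph_inj (@ratr algC)); rewrite [LHS]Hz /= ratr_int.
Qed.

Lemma OK_int (z : int) : OK z%:~R.
Proof. exact: (@integral_id _ _ (intr : {rmorphism int -> K})). Qed.

(** x is a root of X^2 - u X + v, whatever the second root y is. *)
Lemma OK_trace_norm (x y : K) (u v : int) :
  x + y = u%:~R -> x * y = v%:~R -> OK x.
Proof.
move=> Hu Hv; exists ('X^2 - (u *: 'X - v%:P)).
  rewrite monicE lead_coefDl ?lead_coefXn // size_polyN size_polyXn.
  apply: leq_ltn_trans (size_polyD _ _) _; rewrite size_polyN gtn_max size_polyC.
  case: (v != 0); rewrite andbT; apply: leq_ltn_trans (size_scale_leq _ _) _;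
    by rewrite size_polyX.
rewrite /root !rmorphB /= map_polyXn map_polyZ map_polyX map_polyC /=.
by rewrite !hornerE /= -Hu -Hv; apply/eqP; ring.
Qed.

Variable sg : {rmorphism K -> K}.
Hypotheses (sg_s : sg s = - s) (sg_alg : forall a : rat, sg a%:A = a%:A).

Lemma sg_sg x : sg (sg x) = x.
Proof.
have [[a b] /= ->] := quad_coord x.
by rewrite !rmorphD !rmorphM /= !sg_alg sg_s rmorphN sg_s opprK.
Qed.

Lemma OK_sg x : OK x -> OK (sg x).
Proof.
case=> q mq rq; exists q => //.
have -> : map_poly (intr : int -> K) q = map_poly sg (map_poly intr q).
  by rewrite -map_poly_comp; apply: eq_map_poly => z /=; rewrite rmorph_int.
by rewrite fmorph_root.
Qed.

Lemma sg_fixed x : sg x = x -> exists a : rat, x = a%:A.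
Proof.
have [[a b] /= ->] := quad_coord x.
rewrite rmorphD rmorphM /= !sg_alg sg_s => E; exists a.
have [_ bN] : a = a /\ - b = b.
  by apply: quad_coord_inj; rewrite scaleNr mulNr -mulrN.
have -> : b = 0 by lra.
by rewrite scale0r mul0r addr0.
Qed.

Lemma OK_fixed x : OK x -> sg x = x -> exists z : int, x = z%:~R.
Proof.
move=> Ox /sg_fixed[a ax]; rewrite ax in Ox *.
have [z ->] := ratr_integral Ox; exists z.
exact: rat_alg_int.
Qed.

Lemma OK_norm x : OK x -> exists z : int, x * sg x = z%:~R.
Proof.
move=> Ox; apply: OK_fixed; first by apply: OKM => //; apply: OK_sg.
by rewrite rmorphM sg_sg mulrC.
Qed.

Lemma OK_trace x : OK x -> exists z : int, x + sg x = z%:~R.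
Proof.
move=> Ox; apply: OK_fixed; first by apply: OKD => //; apply: OK_sg.
by rewrite rmorphD sg_sg addrC.
Qed.

(** With x = a + b s, trace u and norm v, one has d (2b)^2 = u^2 - 4v, so 2b is an integer by
    [squarefree_ratr_sq]. *)
Lemma OK_coord x : OK x -> exists a b : int, x + x = a%:~R + b%:~R * s.
Proof.
move=> Ox; have [u Hu] := OK_trace Ox; have [v Hv] := OK_norm Ox.
have [[a b] /= xE] := quad_coord x.
have sgx : sg x = a%:A - b%:A * s.
  by rewrite xE rmorphD rmorphM /= !sg_alg sg_s mulrN.
have Ha : 2 * a = u%:~R.
  by apply: (@rat_alg_inj K); rewrite !rat_algE -Hu sgx xE; ring.
have Hb : d%:R * (2 * b) ^+ 2 = (u ^+ 2 - 4 * v)%:~R.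
  have -> : (u ^+ 2 - 4 * v)%:~R = u%:~R ^+ 2 - 4 * v%:~R :> rat by ring.
  apply: (@rat_alg_inj K); rewrite !rat_algE -Hu -Hv sgx xE -s2.
  by ring.
have [z Hz] := squarefree_ratr_sq d_sqf Hb.
exists u, z; rewrite -(rat_alg_int K u) -(rat_alg_int K z) -Ha -Hz xE.
by rewrite !rat_algE; ring.
Qed.

(** * Conjugate ideals and inverses of ideal classes *)

Definition ideal_conj (I : set K) : set K := [set sg x | x in I]%classic.

Lemma ideal_conjM (I J : set K) :
  (ideal_mul (ideal_conj I) (ideal_conj J) `<=` ideal_conj (ideal_mul I J))%classic.
Proof.
apply: ideal_mul_min.
- by exists 0; [exact: ideal_mul0 | rewrite rmorph0].
- move=> _ _ [x Ix <-] [y Iy <-]; exists (x + y); last by rewrite rmorphD.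
  exact: ideal_mulD.
- move=> _ _ [x Ix <-] [y Iy <-]; exists (x * y); last by rewrite rmorphM.
  exact: ideal_mul_gen.
Qed.

Lemma is_frac_ideal_conj (I : set K) : is_frac_ideal I -> is_frac_ideal (ideal_conj I).
Proof.
case=> I0 ID IZ [x Ix x0] [c [Oc c0] Hc]; split.
- by exists 0; rewrite ?rmorph0.
- by move=> _ _ [y Iy <-] [z Iz <-]; exists (y + z); rewrite ?rmorphD //; apply: ID.
- move=> a _ Oa [y Iy <-]; exists (sg a * y); last by rewrite rmorphM sg_sg.
  by apply: IZ => //; apply: OK_sg.
- by exists (sg x); [exists x | rewrite fmorph_eq0].
- exists (sg c); first by split; [apply: OK_sg | rewrite fmorph_eq0].
  by move=> _ [y Iy <-]; rewrite -rmorphM; apply/OK_sg/Hc.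
Qed.

(* The generator is the gcd [g] of the norms of the elements of [I]: for x, y  *)
(* in [I], the element x * sg y / g has integral trace and norm.               *)
Lemma ideal_mul_conj (I : set K) : is_frac_ideal I -> (forall x, I x -> OK x) ->
  exists2 g : K, g != 0 & ideal_mul I (ideal_conj I) = ideal_scale g OK.
Proof.
move=> fI IO; have [_ ID _ [x0 Ix0 x00] _] := fI.
have [J0 JD JZ _ _] := is_frac_idealM fI (is_frac_ideal_conj fI).
set J := ideal_mul _ _ in J0 JD JZ *.
pose H (m : int) := J m%:~R.
have HM a b : H b -> H (a * b).
  by move=> Hb; rewrite /H intrM; apply: JZ => //; apply: OK_int.
have HD a b : H a -> H b -> H (a + b) by move=> Ha Hb; rewrite /H intrD; apply: JD.
have HN x v : I x -> x * sg x = v%:~R -> H v.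
  by move=> Ix xv; rewrite /H -xv; apply: ideal_mul_gen => //; exists x.
(* [g] will be the least positive rational integer in [J]; by Euclidean division it divides all the
   others, the norms from [I] included. *)
have exg : exists m : nat, (0 < m)%N && `[< H m%:Z >].
  have [v Hv] := OK_norm (IO _ Ix0).
  have v0 : v != 0.
    by apply/eqP=> v0; move/eqP: Hv; rewrite v0 mulf_eq0 fmorph_eq0 (negPf x00).
  exists `|v|%N; rewrite absz_gt0 v0 /=; apply/asboolP.
  by rewrite abszE normrEsg; apply: HM; apply: HN Hv.
have [g /andP[g_gt0 /asboolP Hg] g_min] := ex_minnP exg.
have g_dvd m : H m -> exists k : int, m = k * g%:Z.
  move=> Hm; exists (m %/ g%:Z)%Z.
  have g0 : g%:Z != 0 by lia.
  suff : (m %% g%:Z)%Z = 0 by have := divz_eq m g%:Z; lia.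
  have Hr : H (m %% g%:Z)%Z.
    have -> : (m %% g%:Z)%Z = m + (- (m %/ g%:Z)%Z) * g%:Z.
      by have := divz_eq m g%:Z; lia.
    by apply: HD => //; apply: HM.
  have := modz_ge0 m g0; have := ltz_pmod m (g_gt0 : 0 < g%:Z).
  case: (m %% g%:Z)%Z Hr => // r Hr r_lt _; have [->//|r0] := posnP r.
  by have := g_min r; rewrite r0 asboolT // => /(_ isT); lia.
have gK0 : g%:R != 0 :> K by rewrite natr_ext_neq0.
exists g%:R => //; apply/seteqP; split; last first.
  by move=> _ [z Oz <-]; rewrite mulrC; apply: JZ.
apply: ideal_mul_min.
- by exists 0; [apply: OK0 | rewrite mulr0].
- move=> _ _ [x Ox <-] [y Oy <-]; exists (x + y); last by rewrite mulrDr.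
  exact: OKD.
move=> x _ Ix [y Iy <-]; exists (x * sg y / g%:R); last by rewrite mulrC divfK.
have [u Hu] := OK_norm (IO _ Ix); have [v Hv] := OK_norm (IO _ Iy).
have [w Hw] := OK_norm (IO _ (ID _ _ Ix Iy)).
have [ku Eu] := g_dvd _ (HN _ _ Ix Hu); have [kv Ev] := g_dvd _ (HN _ _ Iy Hv).
have [kw Ew] := g_dvd _ (HN _ _ (ID _ _ Ix Iy) Hw).
(* Polarisation: x * sg y + sg x * y = N(x + y) - N(x) - N(y), a multiple of g; the norm is (N(x) /
   g) (N(y) / g). *)
apply: (@OK_trace_norm _ (sg x * y / g%:R) (kw - ku - kv) (ku * kv)).
  apply: (mulIf gK0); rewrite !intrB !mulrBl.
  have EK k m : m = k * g%:Z -> k%:~R * g%:R = m%:~R :> K by move->; rewrite intrM.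
  rewrite (EK _ _ Eu) (EK _ _ Ev) (EK _ _ Ew) -Hu -Hv -Hw rmorphD.
  by field.
apply: (mulIf (mulf_neq0 gK0 gK0)).
have -> : (ku * kv)%:~R * (g%:R * g%:R) = u%:~R * v%:~R :> K.
  by rewrite Eu Ev !intrM; ring.
by rewrite -Hu -Hv; field.
Qed.

Lemma is_frac_ideal_scale (c : K) (I : set K) :
  OK c -> c != 0 -> is_frac_ideal I -> is_frac_ideal (ideal_scale c I).
Proof.
move=> Oc c0 [I0 ID IZ [x Ix x0] [b [Ob b0] Hb]]; split.
- by exists 0; rewrite ?mulr0.
- by move=> _ _ [y Iy <-] [z Iz <-]; exists (y + z); rewrite ?mulrDr //; apply: ID.
- by move=> a _ Oa [y Iy <-]; exists (a * y); [apply: IZ | rewrite mulrCA].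
- by exists (c * x); [exists x | rewrite mulf_neq0].
- exists b => // _ [y Iy <-]; rewrite mulrCA.
  by apply: OKM => //; apply: Hb.
Qed.

(** The inverse is the class of the conjugate of an integral representative, obtained by clearing a
    denominator c. *)
Lemma class_mul_inv (x : class_group K) : exists y, class_mul x y = class_one K.
Proof.
pose I := repr x; have fI := frac_idealP I.
have [_ _ _ _ [c [Oc c0] Hc]] := fI.
have fJ := is_frac_ideal_scale Oc c0 fI.
pose J : frac_ideal K := Sub (ideal_scale c (val I)) (asboolT fJ).
pose J' : frac_ideal K := Sub (ideal_conj (val J)) (asboolT (is_frac_ideal_conj fJ)).
have -> : x = ideal_class J.
  rewrite -[x]reprK; apply/ideal_classP; exists c^-1; rewrite ?invr_eq0 //.
  by rewrite ideal_scale_comp mulVf // ideal_scale1.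
exists (ideal_class J'); rewrite class_mulE; apply/ideal_classP.
have [|g g0 gE] := ideal_mul_conj fJ; last by exists g.
by move=> _ [y Iy <-]; apply: Hc.
Qed.

(** * Elements of small norm when d = n^2 + 1 *)

Variable n : nat.
Hypothesis d_def : d = (n ^ 2 + 1)%N.

(* Descent: one of the units s + n and s - n decreases the coefficient of s,   *)
(* unless it is 0 or the norm is at least n / 2.                               *)
Lemma small_norm_associate (x : K) (v : int) :
    OK x -> x * sg x = v%:~R -> (2 * `|v| < n)%N ->
  exists (e : K) (z : int), [/\ OK e, OK e^-1, e != 0 & x = z%:~R * e].
Proof.
move=> + + v_lt; have Os : OK s.
  by apply: (@OK_trace_norm _ (- s) 0 (- d%:Z)); rewrite ?subrr // mulrN -expr2 s2 intrN.
(* Induction on a bound m for |b|, where 2x = a + b s. *)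
suff H m : forall (x : K) (v a b : int), OK x -> x * sg x = v%:~R ->
    (2 * `|v| < n)%N -> x + x = a%:~R + b%:~R * s -> (`|b| <= m)%N ->
    exists (e : K) (z : int), [/\ OK e, OK e^-1, e != 0 & x = z%:~R * e].
  move=> Ox xv; have [a [b Hab]] := OK_coord Ox.
  exact: H Ox xv v_lt Hab (leqnn _).
elim: m {x v v_lt} => [|m IH] x v a b Ox xv v_lt Hab b_le.
  have b0 : b = 0 by lia.
  have two0 : 2 != 0 :> K by rewrite natr_ext_neq0.
  have xs : sg x = x.
    apply: (mulfI two0); rewrite !mulr_natl !mulr2n -rmorphD Hab b0 mul0r addr0.
    by rewrite rmorph_int.
  have [z xz] := OK_fixed Ox xs.
  by exists 1, z; rewrite invr1 mulr1 oner_neq0; split=> //; apply: OK1.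
have [b0|b0] := eqVneq b 0; first by apply: IH Ox xv v_lt Hab _; rewrite b0.
have Hv : 4 * v = a ^+ 2 - d%:Z * b ^+ 2.
  apply: (@intr_inj rat); apply: (@rat_alg_inj K); rewrite !rat_alg_int.
  have -> : (a ^+ 2 - d%:Z * b ^+ 2)%:~R =
      (a%:~R + b%:~R * s) * (a%:~R - b%:~R * s) :> K.
    by transitivity (a%:~R ^+ 2 - d%:R * b%:~R ^+ 2 : K); [ring | rewrite -s2; ring].
  have -> : a%:~R - b%:~R * s = sg (a%:~R + b%:~R * s) :> K.
    by rewrite rmorphD rmorphM !rmorph_int sg_s mulrN.
  by rewrite -Hab intrM -xv rmorphD; ring.
have B0 : (0 < `|b|)%N by rewrite absz_gt0.
have HA : 4 * v = `|a|%N%:Z ^+ 2 - (n%:Z ^+ 2 + 1) * `|b|%N%:Z ^+ 2.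
  by rewrite Hv d_def !abszE !real_normK ?num_real.
have [H1 H2] := small_norm_window B0 HA v_lt.
have [e [e2 lt_e]] := small_norm_shift H1 H2.
(* [y] is a unit of norm -1 with inverse [y'], as s^2 - n^2 = 1. Multiplying by it sends v to -v and
   b to a + e n b. *)
pose y := s + (e * n%:Z)%:~R; pose y' := s - (e * n%:Z)%:~R.
have yy' : y * y' = 1.
  rewrite /y /y'; transitivity (s ^+ 2 - (e ^+ 2 * n%:Z ^+ 2)%:~R); first by ring.
  by rewrite e2 s2 d_def mul1r natrD natrX rmorphXn /=; ring.
have sgy : sg y = - y' by rewrite /y /y' rmorphD rmorph_int sg_s; ring.
have Oy : OK y by apply: OKD => //; apply: OK_int.
have Oy' : OK y' by apply: OKD => //; rewrite -intrN; apply: OK_int.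
have y0 : y != 0 by apply: contra_eq_neq yy' => ->; rewrite mul0r eq_sym oner_neq0.
have [||||f [z [Of Of' f0 E]]] :=
  IH (x * y) (- v) (e * n%:Z * a + d%:Z * b) (a + e * n%:Z * b) (OKM Ox Oy).
- by rewrite rmorphM sgy mulrACA xv mulrN yy' intrN mulrN1.
- by rewrite abszN.
- rewrite -mulrDl Hab /y; transitivity ((e * n%:Z * a)%:~R + s ^+ 2 * b%:~R +
    (a + e * n%:Z * b)%:~R * s : K); first by ring.
  by rewrite s2; ring.
- by move: lt_e b_le; lia.
have y'E : y' = y^-1 by apply: (mulfI y0); rewrite yy' mulfV.
exists (f * y'), z; split.
- exact: OKM.
- by rewrite y'E invfM invrK; apply: OKM.
- by rewrite mulf_neq0 // y'E invr_eq0.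
- by rewrite mulrA -E -mulrA yy' mulr1.
Qed.

(** * The ideal P = (p, w) and the order of its class *)

Variables p t : nat.
Hypotheses (p_prime : prime p) (t_gt0 : (0 < t)%N) (n_def : n = (2 * p ^ t)%N).

Let w : K := (1 + s) / 2%:R.

Let two_neq0 : 2%:R != 0 :> K.
Proof. exact: natr_ext_neq0. Qed.

Let trace_w : w + sg w = 1.
Proof. by rewrite /w rmorphM rmorphD fmorphV rmorph1 rmorph_nat sg_s; field. Qed.

(** The norm is (1 - d) / 4 = -(n / 2)^2 with n / 2 = p^t. *)
Let norm_w : w * sg w = - p%:R ^+ (2 * t).
Proof.
rewrite /w rmorphM rmorphD fmorphV rmorph1 rmorph_nat sg_s.
have four_neq0 : 4%:R != 0 :> K by rewrite natr_ext_neq0.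
transitivity ((1 - s ^+ 2) / 4%:R); first by field; apply/andP.
by rewrite s2 d_def n_def natrD natrX natrM natrX exprM exprAC; field.
Qed.

Let OK_w : OK w.
Proof.
apply: (@OK_trace_norm _ (sg w) 1 (- (p ^ (2 * t))%:Z)); first exact: trace_w.
by rewrite norm_w intrN -pmulrn natrX.
Qed.

Let w2 : w ^+ 2 = w + p%:R ^+ (2 * t).
Proof.
rewrite -[p%:R ^+ _]opprK -norm_w -(addrK w (sg w)) (addrC (sg w)) trace_w; ring.
Qed.

Let pX2t : p%:R ^+ (2 * t) = p%:R * (p ^ (2 * t).-1)%N%:~R :> K.
Proof. by rewrite -pmulrn natrX -exprS prednK // muln_gt0. Qed.

Let OK_p : OK p%:R. Proof. exact: (OK_int p). Qed.

Let P : set K := [set z | exists u v, [/\ OK u, OK v & z = p%:R * u + w * v]]%classic.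

Let P_frac : is_frac_ideal P.
Proof.
split.
- by exists 0, 0; split; [exact: OK0 | exact: OK0 | rewrite !mulr0 addr0].
- move=> _ _ [u [v [Ou Ov ->]]] [u' [v' [Ou' Ov' ->]]].
  by exists (u + u'), (v + v'); split; [exact: OKD | exact: OKD | ring].
- move=> a _ Oa [u [v [Ou Ov ->]]].
  by exists (a * u), (a * v); split; [exact: OKM | exact: OKM | ring].
- exists p%:R; last by rewrite natr_ext_neq0 // prime_gt0.
  exists 1, 0.
  by split; [exact: OK1 | exact: OK0 | rewrite mulr0 mulr1 addr0].
- exists 1; first by rewrite oner_neq0; split => //; exact: OK1.
  by move=> _ [u [v [Ou Ov ->]]]; rewrite mul1r; apply: OKD; apply: OKM.
Qed.

Let P_OK x : P x -> OK x.
Proof. by move=> [u [v [Ou Ov ->]]]; apply: OKD; apply: OKM. Qed.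

(** N(p u + w v) = p^2 N(u) + p Tr(u * sg (w v)) + N(w) N(v), and p divides N(w). *)
Let P_norm x : P x -> exists m : int, x * sg x = (p%:Z * m)%:~R.
Proof.
move=> [u [v [Ou Ov ->]]].
have [a Ha] := OK_norm Ou; have [b Hb] := OK_norm Ov.
have [c Hc] := OK_trace (OKM Ou (OK_sg (OKM OK_w Ov))).
exists (p%:Z * a + c - (p ^ (2 * t).-1)%:Z * b).
have -> : (p%:Z * (p%:Z * a + c - (p ^ (2 * t).-1)%:Z * b))%:~R =
  p%:R * (p%:R * a%:~R + c%:~R) + (- p%:R ^+ (2 * t)) * b%:~R :> K.
  rewrite pX2t; move: (Posz (p ^ _)) => pk; rewrite (pmulrn 1 p); ring.
rewrite -norm_w -Ha -Hb -Hc [sg (u * _)]rmorphM sg_sg rmorphD /=.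
rewrite [sg (p%:R * u)]rmorphM [sg (w * v)]rmorphM rmorph_nat.
by ring.
Qed.

Let PI : frac_ideal K := Sub P (asboolT P_frac).

Let Pk k : frac_ideal K := iter k (frac_ideal_mul PI) (frac_ideal_one K).

Let class_Pk k : ideal_class (Pk k) = (ideal_class PI ^+ k)%g.
Proof.
elim: k => [|k IH]; first by [].
by rewrite expgS -IH -[RHS]/(class_mul _ _) class_mulE.
Qed.

Let Pk_OK k x : val (Pk k) x -> OK x.
Proof.
elim: k x => [//|k IH] x; move: x; apply: ideal_mul_min.
- exact: OK0.
- exact: OKD.
- by move=> x y /P_OK Ox /IH Oy; apply: OKM.
Qed.

Let PkS_P k x : val (Pk k.+1) x -> P x.
Proof.
have [P0 PD PZ _ _] := P_frac.
move: x; apply: ideal_mul_min => // x y Px /Pk_OK Oy.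
by rewrite mulrC; apply: PZ.
Qed.

Let Pk_w k : val (Pk k) (w ^+ k).
Proof.
elim: k => [|k IH]; first exact: OK1.
rewrite exprS; apply: ideal_mul_gen => //.
by exists 0, 1; split; [exact: OK0 | exact: OK1 | rewrite mulr0 mulr1 add0r].
Qed.

Let Pk_norm k : ideal_mul (val (Pk k)) (ideal_conj (val (Pk k))) (p%:R ^+ k).
Proof.
elim: k => [|k IH].
  rewrite -[p%:R ^+ 0]mulr1.
  by apply: ideal_mul_gen; [|exists 1; rewrite ?rmorph1 //]; exact: OK1.
have PP : ideal_mul P (ideal_conj P) p%:R.
  have Pp : P p%:R by exists 1, 0; split; [exact: OK1 | exact: OK0 | ring].
  have Pw : P w by exists 0, 1; split; [exact: OK0 | exact: OK1 | ring].
  (* Since w has trace 1; each summand is an element of P times one of its conjugate. *)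
  have -> : p%:R = w * p%:R + p%:R * sg w :> K.
    by rewrite [w * _]mulrC -mulrDr trace_w mulr1.
  apply: ideal_mulD.
    by apply: ideal_mul_gen => //; exists p%:R; rewrite ?rmorph_nat.
  by apply: ideal_mul_gen => //; exists w.
have := ideal_mul_gen PP IH; rewrite -exprS.
rewrite -ideal_mulA (ideal_mulA (ideal_conj P)) (ideal_mulC (ideal_conj P)).
rewrite -ideal_mulA ideal_mulA.
apply: ideal_mul_min; [exact: ideal_mul0 | exact: ideal_mulD |].
by move=> x y Hx /ideal_conjM Hy; apply: ideal_mul_gen.
Qed.

(** The traces T_k of w^k satisfy T_(k+2) = T_(k+1) + p^(2t) T_k with T_1 = 1. The exponent starts
    at 1 because T_0 = 2. *)
Let trace_wX k : exists m : int, w ^+ k.+1 + sg w ^+ k.+1 = (1 + p%:Z * m)%:~R.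
Proof.
suff [_ //] : (exists a : int, w ^+ k + sg w ^+ k = a%:~R) /\
  (exists m : int, w ^+ k.+1 + sg w ^+ k.+1 = (1 + p%:Z * m)%:~R).
elim: k => [|k [[a Ha] [m Hm]]].
  split; first by exists 2; rewrite !expr0.
  by exists 0; rewrite !expr1 trace_w mulr0 addr0.
split; first by exists (1 + p%:Z * m).
exists (m + (p ^ (2 * t).-1)%:Z * a).
have sw2 : sg w ^+ 2 = sg w + p%:R ^+ (2 * t).
  by rewrite -rmorphXn w2 rmorphD rmorphXn rmorph_nat.
transitivity ((1 + p%:Z * m)%:~R + p%:R ^+ (2 * t) * a%:~R : K); last first.
  rewrite pX2t; move: (Posz (p ^ _)) => pk; rewrite (pmulrn 1 p); ring.
have E (x : K) : x ^+ 2 = x + p%:R ^+ (2 * t) ->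
    x ^+ k.+2 = x ^+ k.+1 + p%:R ^+ (2 * t) * x ^+ k.
  by move=> x2; rewrite -addn2 exprD x2 exprS; ring.
by rewrite (E _ w2) (E _ sw2) -Hm -Ha; ring.
Qed.

Lemma prime_class_order : exists c : class_group K,
  forall k, (0 < k)%N -> (c ^+ k = 1)%g -> (t <= k)%N.
Proof.
exists (ideal_class PI) => -[//|k] _; rewrite -class_Pk => /ideal_classP[g g0 Eg].
rewrite leqNgt; apply/negP=> k_lt.
have Pg : val (Pk k.+1) g by rewrite Eg; exists 1; rewrite ?mulr1 //; exact: OK1.
have Og := Pk_OK Pg; have [v Hv] := OK_norm Og.
have v0 : v%:~R != 0 :> K by rewrite -Hv mulf_neq0 // fmorph_eq0.
(* The ideal (g) times its conjugate is (N(g)), so v divides p^(k+1) in the ring of integers, hence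
   in the rational integers because the quotient z is fixed by [sg]. *)
have [z Oz zE] : exists2 z, OK z & p%:R ^+ k.+1 = v%:~R * z.
  have := Pk_norm k.+1; move: (_ ^+ _); rewrite Eg; apply: ideal_mul_min.
  - by exists 0; rewrite ?mulr0 //; exact: OK0.
  - by move=> _ _ [x Ox ->] [y Oy ->]; exists (x + y); [exact: OKD | rewrite mulrDr].
  - move=> _ _ [x Ox <-] [_ [y Oy <-] <-]; exists (x * sg y).
      by apply: OKM => //; apply: OK_sg.
    by rewrite rmorphM -Hv mulrACA.
have [|z' z'E] := OK_fixed Oz.
  by apply: (mulfI v0); rewrite -zE -{1}(rmorph_int sg) -rmorphM -zE rmorphXn rmorph_nat.
have vz : p%:Z ^+ k.+1 = v * z'.
  apply: (@intr_inj rat); apply: (@rat_alg_inj K); rewrite !rat_alg_int.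
  by rewrite intrM -z'E -zE rmorphXn.
have v_le : (`|v| <= p ^ k.+1)%N.
  move/(congr1 absz): vz; rewrite abszM abszX absz_nat => vz.
  by apply: dvdn_leq; rewrite ?expn_gt0 ?prime_gt0 // vz dvdn_mulr.
have [|e [m [Oe Oe' e0 gE]]] := small_norm_associate Og Hv.
  rewrite n_def ltn_pmul2l //; apply: leq_ltn_trans v_le _.
  by rewrite ltn_exp2l // prime_gt1.
have Pm : P m%:~R.
  have [_ _ PZ _ _] := P_frac.
  have -> : m%:~R = e^-1 * g by rewrite gE mulrC mulfK.
  exact/PZ/(PkS_P Pg).
have [a] := P_norm Pm; rewrite rmorph_int => Ha.
have p_m : (p %| `|m|)%N.
  have {}Ha : m * m = p%:Z * a.
    by apply: (@intr_inj rat); apply: (@rat_alg_inj K); rewrite !rat_alg_int intrM.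
  move/(congr1 absz): Ha; rewrite !abszM absz_nat => Ha.
  by have := dvdn_mulr `|a|%N (dvdnn p); rewrite -Ha Euclid_dvdM // orbb.
(* As e is a unit, w^(k+1) in P^(k+1) = (g) is a multiple of m; comparing traces gives 1 + p b = m c
   with p | m. *)
have [y Oy yE] : exists2 y, OK y & w ^+ k.+1 = m%:~R * y.
  have := Pk_w k.+1; rewrite Eg => -[y Oy <-]; exists (e * y); first exact: OKM.
  by rewrite gE mulrA.
have [b Hb] := trace_wX k; have [c Hc] := OK_trace Oy.
have Ec : 1 + p%:Z * b = m * c.
  apply: (@intr_inj rat); apply: (@rat_alg_inj K); rewrite !rat_alg_int.
  by rewrite -Hb intrM -Hc -rmorphXn yE rmorphM rmorph_int mulrDr.
have : (p%:Z %| m * c - p%:Z * b)%Z by rewrite rpredB ?dvdz_mulr.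
rewrite -Ec addrK dvdz1 absz_nat => /eqP p1.
by have := p_prime; rewrite p1.
Qed.

End QuadraticField.

(** * Lagrange's theorem and cyclicity for a finite class group *)

Section FiniteClassGroup.

Variables (K : fieldExtType rat) (N : nat).
Hypotheses (card_K : class_number K = N) (N_gt1 : (1 < N)%N).
Hypothesis class_inv : forall x : class_group K, exists y, class_mul x y = class_one K.

Let classes : seq (class_group K) := enum_fset (fset_set [set: class_group K]%classic).

Let mem_classes x : x \in classes.
Proof.
have fin : finite_set [set: class_group K]%classic.
  (* An infinite class group would have [class_number] 0, against N > 1. *)
  apply: contrapT => inf; move: N_gt1; rewrite -card_K /class_number.
  by rewrite /fset_set; case: pselect => // _; rewrite cardfs0.
by have := in_fset_set fin x; rewrite in_setT.
Qed.

Let uniq_classes : uniq classes. Proof. exact: fset_uniq. Qed.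

Let size_classes : size classes = N.
Proof. exact: card_K. Qed.

Lemma class_mulI (x : class_group K) : injective (class_mul x).
Proof.
move=> y z E; have [x' xx'] := class_inv x.
rewrite -(class_mul1 y) -(class_mul1 z) -xx' (class_mulC x) -!class_mulA.
by rewrite E.
Qed.

HB.instance Definition _ := Monoid.isComLaw.Build (class_group K) (class_one K)
  (@class_mul K) (@class_mulA K) (@class_mulC K) (@class_mul1 K).

(* Multiplication by [c] permutes the classes, so it fixes their product. *)
Lemma class_expg_number (c : class_group K) : (c ^+ N = 1)%g.
Proof.
pose op := @class_mul K; pose pr := \big[op/class_one K]_(x <- classes) x.
have perm_c : perm_eq (map (class_mul c) classes) classes.
  apply: uniq_perm => //; first by rewrite map_inj_uniq //; apply: class_mulI.
  move=> x; rewrite mem_classes; apply/mapP.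
  have [c' cc'] := class_inv c; exists (class_mul c' x) => //.
  by rewrite class_mulA cc' class_mul1.
have E : class_mul pr (c ^+ N)%g = class_mul pr (class_one K).
  rewrite class_mulr1 {2}/pr -(perm_big _ perm_c) big_map big_split class_mulC.
  congr class_mul; rewrite big_const_seq count_predT size_classes.
  by elim: (N) => // k IH; rewrite expgS iterS -IH.
exact: class_mulI E.
Qed.

(** The powers c^0, ..., c^(N-1) are distinct, hence exhaust the N classes; c^N = 1 makes reduction
    of exponents modulo N harmless. *)
Lemma cyclic_class_group (c : class_group K) :
    (forall k, (0 < k < N)%N -> (c ^+ k <> 1)%g) ->
  exists2 f : 'Z_N -> class_group K,
    bijective f & {morph f : x y / x + y >-> (x * y)%g}.
Proof.
move=> c_order; pose f (x : 'Z_N) := (c ^+ x)%g.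
have f_inj : injective f.
  have H (i j : nat) : (i < j < N)%N -> (c ^+ i = c ^+ j)%g -> False.
    move=> ij E; apply: (@c_order (j - i)%N); first lia.
    apply: (@class_mulI (c ^+ i)%g); rewrite class_mulr1.
    transitivity (c ^+ (i + (j - i)))%g; first by rewrite expgnDr.
    by rewrite E; congr (_ ^+ _)%g; lia.
  move=> x y E; apply: val_inj => /=.
  (* ['Z_N] really has N elements only when N > 1. *)
  have ltN (z : 'Z_N) : (z < N)%N by rewrite -[X in (_ < X)%N](Zp_cast N_gt1).
  have [xy|yx|//] := ltngtP x y.
    by case: (H x y); rewrite ?xy ?ltN.
  by case: (H y x); rewrite ?yx ?ltN.
have f_surj y : exists x, f x = y.
  have [|||_ E] := @uniq_min_size _ (map f (enum 'Z_N)) classes.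
  - by rewrite map_inj_uniq ?enum_uniq.
  - by move=> z _; apply: mem_classes.
  - by rewrite size_map -cardE card_ord Zp_cast // size_classes.
  by have := E y; rewrite mem_classes => /mapP[x _ ->]; exists x.
exists f; first by have [g gK] := choice f_surj; exists g => // x; apply: f_inj.
move=> x y; rewrite /f -expgnDr /= [X in (_ %% X)%N](Zp_cast N_gt1).
rewrite [in RHS](divn_eq (x + y) N) expgnDr mulnC expgnA class_expg_number.
by rewrite expg1n mul1g.
Qed.

End FiniteClassGroup.

(** * From the bound t on the order to a class of order q^r *)

Theorem theorem6p1 (n p t d : nat) (K : fieldExtType rat) (q r : nat)
    (p_prime : prime p) (p_odd : odd p) (t_ge1 : (1 <= t)%N)
    (n_def : n = (2 * p ^ t)%N) (d_def : d = (n ^ 2 + 1)%N)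
    (d_sqfree : squarefree d)
    (K_def : is_rat_sqrt_field d K)
    (q_prime : prime q) (r_ge2 : (2 <= r)%N)
    (h_def : class_number K = (q ^ r)%N)
    (t_large : (q ^ (r - 1) < t)%N) :
  exists2 f : 'Z_(q ^ r) -> class_group K,
    bijective f & {morph f : x y / (x + y)%R >-> (x * y)%g}.
Proof.
have [s s2 gen] := K_def.
have d_gt1 : (1 < d)%N.
  by rewrite d_def n_def addn1 ltnS !(expn_gt0, muln_gt0) (prime_gt0 p_prime).
have [sg [sg_s sg_alg]] := quad_conj s2 gen d_sqfree d_gt1.
have inv := class_mul_inv s2 gen d_sqfree d_gt1 sg_s sg_alg.
have [c c_order] := prime_class_order s2 gen d_sqfree d_gt1 sg_s sg_alg d_def
  p_prime t_ge1 n_def.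
have N_gt1 : (1 < q ^ r)%N by rewrite -{1}(expn0 q) ltn_exp2l ?prime_gt1 //; lia.
have c1 := class_expg_number h_def N_gt1 inv c.
apply: (cyclic_class_group h_def N_gt1 inv (c := c)) => k /andP[k_gt0 k_lt] ck.
(* By Bezout, c^k = 1 and c^(q^r) = 1 give c^o = 1. Here o = q^j with o <= k < q^r, so o <= q^(r-1)
   < t, against the bound t <= o. *)
pose o := gcdn k (q ^ r).
have co : (c ^+ o = 1)%g.
  have [u v] := egcdnP (q ^ r)%N k_gt0.
  move=> E _; have : (c ^+ (u * k) = c ^+ (v * q ^ r + o))%g by rewrite E.
  by rewrite expgnDr (mulnC u) (mulnC v) !expgnA ck c1 !expg1n mul1g.
have /dvdn_pfactor : (o %| q ^ r)%N := dvdn_gcdr k _.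
move=> /(_ q_prime)[j j_le oE].
have o_lt : (o < q ^ r)%N by apply: leq_ltn_trans k_lt; apply/dvdn_leq/dvdn_gcdl.
have := c_order o; rewrite gcdn_gt0 k_gt0 => /(_ isT co).
apply/negP; rewrite -ltnNge; apply: leq_ltn_trans t_large.
move: o_lt; rewrite oE ltn_exp2l ?prime_gt1 // => j_lt.
by rewrite leq_exp2l ?prime_gt1 //; lia.
Qed.
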